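(* Let $\mathcal{T}(\mathcal{N})$ be a continuous nest algebra on a complex Hilbert space $\mathfrak{H}$, let $\mathfrak{L}$ be a norm closed Lie ideal of $\mathcal{T}(\mathcal{N})$ and let $T$ be a finite rank operator in $\mathfrak{L}$. Then $T$ can be written as a finite sum of rank one operators lying in $\mathfrak{L}$.
   Context: $\mathfrak{H}$ is a complex Hilbert space and $\mathcal{B}(\mathfrak{H})$ is the algebra of bounded linear operators on $\mathfrak{H}$. Projections are orthogonal projections, ordered as usual, and $P^\perp=I-P$. A nest $\mathcal{N}$ is a totally ordered family of projections in $\mathcal{B}(\mathfrak{H})$ containing $0$ and $I$; throughout, nests are complete, i.e. $\mathcal{N}$ is a complete sublattice of the lattice of projections in $\mathcal{B}(\mathfrak{H})$. For $P\in\mathcal{N}$, $P_-=\bigvee\{Q\in\mathcal{N}:Q<P\}$ if $P\neq0$, and $0_-=0$. A complete nest is continuous if $P_-=P$ for all $P\in\mathcal{N}$. The nest algebra is $\mathcal{T}(\mathcal{N})=\{T\in\mathcal{B}(\mathfrak{H}): P^\perp TP=0 \text{ for all } P\in\mathcal{N}\}$; it is called a continuous nest algebra if $\mathcal{N}$ is continuous. A Lie ideal of $\mathcal{T}(\mathcal{N})$ is a complex subspace $\mathfrak{L}\subseteq\mathcal{T}(\mathcal{N})$ with $[\mathfrak{L},\mathcal{T}(\mathcal{N})]\subseteq\mathfrak{L}$, where $[T,S]=TS-ST$. The zero operator is regarded as an empty sum of rank one operators. *)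

(* Defs.v *)
From HB Require Import structures.
From mathcomp Require Import all_boot all_order all_algebra.
From mathcomp Require Import sesquilinear complex.
From mathcomp Require Import boolp classical_sets functions reals.
From mathcomp Require Import topology normedtype.

Set Implicit Arguments.
Unset Strict Implicit.
Unset Printing Implicit Defensive.

Import Order.TTheory GRing.Theory Num.Theory.
Import numFieldNormedType.Exports.

Local Open Scope classical_set_scope.
Local Open Scope ring_scope.
Local Open Scope complex_scope.

(* The inner product is linear in its first argument and conjugate-linear in
   its second one. *)
HB.mixin Record isHilbert (R : realType) H & CompleteNormedModule R[i] H := {
  dot : {dot H for (@Num.conj R[i])} ;
  dot_normE : forall x : H, dot x x = `|x| ^+ 2
}.

#[short(type="hilbertType")]
HB.structure Definition Hilbert (R : realType) :=
  {H of CompleteNormedModule R[i] H & isHilbert R H}.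

Section BoundedOperators.
Context {R : realType} (H : hilbertType R).
Implicit Types (f : H -> H) (x y : H).

Let rcD (a b : R) : (a + b)%:C = a%:C + b%:C :> R[i].
Proof. exact: rmorphD. Qed.
Let rcM (a b : R) : (a * b)%:C = a%:C * b%:C :> R[i].
Proof. exact: rmorphM. Qed.
Let rcRe (a : R[i]) : (complex.Re `|a|)%:C = `|a|.
Proof. by rewrite RRe_real ?normr_real. Qed.
Let rcReH x : (complex.Re `|x|)%:C = `|x|.
Proof. by rewrite RRe_real ?normr_real. Qed.

Definition bounded_linear : {pred H -> H} :=
  [pred f | `[< linear f /\
                exists M : R, forall x, `|f x| <= M%:C * `|x| >]].

Record bop := Bop {
  bop_fun :> H -> H ;
  _ : bop_fun \in bounded_linear
}.

HB.instance Definition _ := [isSub for bop_fun].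
HB.instance Definition _ := [Choice of bop by <:].

Fact bounded_linear_submod_closed : submod_closed bounded_linear.
Proof.
split=> [|a f g].
  apply/asboolP; split; first by move=> a x y; rewrite scaler0 addr0.
  by exists 0 => x; rewrite normr0 mul0r.
move=> /asboolP[lf [Mf hf]] /asboolP[lg [Mg hg]]; apply/asboolP; split.
  move=> b x y; rewrite !fctE lf lg !scalerDr !scalerA (mulrC a b).
  by rewrite addrACA.
exists (complex.Re `|a| * Mf + Mg) => x; rewrite rcD rcM rcRe mulrDl (le_trans (ler_normD _ _)) //.
by rewrite lerD // normrZ -mulrA ler_wpM2l.
Qed.

HB.instance Definition _ :=
  GRing.isSubmodClosed.Build _ _ bounded_linear bounded_linear_submod_closed.
HB.instance Definition _ := [SubChoice_isSubLmodule of bop by <:].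

Implicit Types S T U : bop.

Lemma bopP S T : S =1 T -> S = T.
Proof. by move=> ST; apply/val_inj/funext. Qed.

Lemma bop_linear T : linear T.
Proof. by case: T => f /= /asboolP[]. Qed.

Lemma bop_bounded T : exists M : R, forall x, `|T x| <= M%:C * `|x|.
Proof. by case: T => f /= /asboolP[]. Qed.

HB.instance Definition _ T :=
  GRing.isLinear.Build R[i] H H *:%R (bop_fun T) (bop_linear T).

Lemma bop_addE S T x : (S + T) x = S x + T x. Proof. by []. Qed.
Lemma bop_oppE T x : (- T) x = - T x. Proof. by []. Qed.
Lemma bop_scaleE a T x : (a *: T) x = a *: T x. Proof. by []. Qed.

Fact bop_one_subproof : (idfun : H -> H) \in bounded_linear.
Proof.
by apply/asboolP; split=> //; exists 1 => x; rewrite rmorph1 mul1r.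
Qed.

Definition bop_one := Bop bop_one_subproof.

Fact bop_mul_subproof S T : (S \o T) \in bounded_linear.
Proof.
apply/asboolP; split=> [a x y|]; first by rewrite /= !linearP.
have [M hM] := bop_bounded S; have [N hN] := bop_bounded T.
have hM' x : `|S x| <= `|M|%:C * `|x|.
  by rewrite (le_trans (hM x)) // ler_wpM2r // lecR ler_norm.
exists (`|M| * N) => x; rewrite rcM -mulrA.
by rewrite (le_trans (hM' _)) // ler_wpM2l // ler0c.
Qed.

Definition bop_mul S T := Bop (bop_mul_subproof S T).

Fact bop_mulA : associative bop_mul.
Proof. by move=> S T U; apply: bopP. Qed.
Fact bop_mul1l : left_id bop_one bop_mul.
Proof. by move=> T; apply: bopP. Qed.
Fact bop_mul1r : right_id bop_one bop_mul.
Proof. by move=> T; apply: bopP. Qed.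
Fact bop_mulDl : left_distributive bop_mul +%R.
Proof. by move=> S T U; apply: bopP. Qed.
Fact bop_mulDr : right_distributive bop_mul +%R.
Proof. by move=> S T U; apply: bopP => x; rewrite /= linearD. Qed.

(* Not a [nzRingType]: 1 = 0 when H is the zero space. *)
HB.instance Definition _ := GRing.Zmodule_isPzRing.Build bop
  bop_mulA bop_mul1l bop_mul1r bop_mulDl bop_mulDr.

Lemma bop_mulE S T x : (S * T) x = S (T x). Proof. by []. Qed.
Lemma bop_1E x : (1 : bop) x = x. Proof. by []. Qed.

Definition opnorm T : R := sup [set complex.Re `|T x| | x in [set x | `|x| <= 1]].

Lemma opnorm_has_sup T : has_sup [set complex.Re `|T x| | x in [set x | `|x| <= 1]].
Proof.
split; first by exists (complex.Re `|T 0|), 0; rewrite //= normr0.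
have [M hM] := bop_bounded T; exists `|M| => _ [x /= x1 <-].
rewrite -lecR rcReH (le_trans (hM x)) //.
rewrite -[leRHS]mulr1 (le_trans (ler_wpM2r _ _ : _ <= `|M|%:C * `|x|)) //.
  by rewrite lecR ler_norm.
by rewrite ler_wpM2l // ler0c.
Qed.

Lemma opnorm_ub T x : `|x| <= 1 -> `|T x| <= (opnorm T)%:C.
Proof.
move=> x1; rewrite -rcReH lecR.
by apply: ub_le_sup; [case: (opnorm_has_sup T)|exists x].
Qed.

Lemma opnorm_lub T (M : R) :
  (forall x, `|x| <= 1 -> `|T x| <= M%:C) -> opnorm T <= M.
Proof.
move=> hM; apply: ge_sup; first by case: (opnorm_has_sup T).
by move=> _ [x /= x1 <-]; rewrite -lecR rcReH hM.
Qed.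

Lemma opnorm_ge0 T : 0 <= opnorm T.
Proof.
by rewrite -ler0c (le_trans _ (opnorm_ub T (x := 0) _)) // normr0.
Qed.

Lemma opnormP T x : `|T x| <= (opnorm T)%:C * `|x|.
Proof.
have [->|x0] := eqVneq x 0; first by rewrite linear0 !normr0 mulr0.
have nx0 : 0 < `|x| by rewrite normr_gt0.
rewrite -ler_pdivrMr //.
have := opnorm_ub T (x := `|x|^-1 *: x).
rewrite linearZ /= !normrZ normfV normr_id mulVf ?gt_eqF // mulrC.
exact.
Qed.

Fact opnormD S T : (opnorm (S + T))%:C <= (opnorm S)%:C + (opnorm T)%:C.
Proof.
rewrite -rcD lecR; apply: opnorm_lub => x x1.
by rewrite rcD (le_trans (ler_normD _ _)) // lerD ?opnorm_ub.
Qed.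

Fact opnormZ_le (a : R[i]) T : opnorm (a *: T) <= complex.Re `|a| * opnorm T.
Proof.
apply: opnorm_lub => x x1; rewrite rcM rcRe.
by rewrite bop_scaleE normrZ ler_wpM2l ?opnorm_ub.
Qed.

Fact opnormZ (a : R[i]) T : (opnorm (a *: T))%:C = `|a| * (opnorm T)%:C.
Proof.
have [->|a0] := eqVneq a 0.
  rewrite normr0 mul0r; congr _%:C; apply/eqP; rewrite eq_le opnorm_ge0 andbT.
  by apply: opnorm_lub => x _; rewrite scale0r normr0.
apply/eqP; rewrite eq_le; apply/andP; split.
  by rewrite -rcRe -rcM lecR opnormZ_le.
have /(_ a^-1 (a *: T)) := opnormZ_le; rewrite scalerA mulVf // scale1r.
rewrite -lecR rcM rcRe normfV.
by rewrite -ler_pdivlMl ?invr_gt0 ?normr_gt0 // invrK.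
Qed.

Fact opnorm_eq0 T : (opnorm T)%:C = 0 -> T = 0.
Proof.
move=> T0; apply: bopP => x; apply/eqP; rewrite -normr_le0.
by rewrite (le_trans (opnormP T x)) // T0 mul0r.
Qed.

HB.instance Definition _ :=
  Lmodule_isNormed.Build R[i] bop opnormD opnormZ opnorm_eq0.

End BoundedOperators.

Section Projections.
Context {R : realType} (H : hilbertType R).
Implicit Types (x y : H).

Definition orthogonal_projection : {pred bop H} :=
  [pred P : bop H | `[< P * P = P /\
                        forall x y, dot (P x) y = dot x (P y) >]].

Record projection := Projection {
  projection_bop :> bop H ;
  _ : projection_bop \in orthogonal_projection
}.

HB.instance Definition _ := [isSub for projection_bop].
HB.instance Definition _ := [Choice of projection by <:].

Implicit Types P Q : projection.

Lemma projection_idem P : (P : bop H) * P = P.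
Proof. by case: P => P /= /asboolP[]. Qed.

Lemma projection_sym P x y : dot (P x) y = dot x (P y).
Proof. by case: P => P /= /asboolP[]. Qed.

Definition proj_le P Q : bool := `[< range P `<=` range Q >].

Lemma proj_leP P Q : reflect ((Q : bop H) * P = P) (proj_le P Q).
Proof.
apply: (iffP (asboolP _)) => [PQ|QP].
  apply: bopP => x; rewrite bop_mulE.
  have [|y _ <-] := PQ (P x); first by exists x.
  by rewrite -bop_mulE projection_idem.
by move=> _ [x _ <-]; exists (P x) => //; rewrite -bop_mulE QP.
Qed.

Fact proj_le_refl : reflexive proj_le.
Proof. by move=> P; apply/asboolP. Qed.

Fact proj_le_anti : antisymmetric proj_le.
Proof.
move=> P Q /andP[/proj_leP QP /proj_leP PQ]; apply/val_inj/bopP => x /=.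
have eqd y : dot (P x) y = dot (Q x) y.
  by rewrite -[in LHS]QP bop_mulE !projection_sym -bop_mulE PQ.
apply/eqP; rewrite -subr_eq0 -normr_eq0 -sqrf_eq0 -dot_normE.
by rewrite linearBl /= eqd subrr.
Qed.

Fact proj_le_trans : transitive proj_le.
Proof.
by move=> Q P S /asboolP PQ /asboolP QS; apply/asboolP; apply: subset_trans QS.
Qed.

Fact proj_display : Order.disp_t. Proof. exact: Order.Disp tt tt. Qed.

HB.instance Definition _ := Order.Le_isPOrder.Build proj_display projection
  proj_le_refl proj_le_anti proj_le_trans.

Fact proj0_subproof : (0 : bop H) \in orthogonal_projection.
Proof.
by apply/asboolP; split=> [|x y]; [rewrite mul0r | rewrite linear0l linear0r].
Qed.
Definition proj0 := Projection proj0_subproof.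

Fact proj1_subproof : (1 : bop H) \in orthogonal_projection.
Proof. by apply/asboolP; split=> //; rewrite mul1r. Qed.
Definition proj1 := Projection proj1_subproof.

End Projections.
Arguments proj0 {R H}.
Arguments proj1 {R H}.

Section NestAlgebras.
Context {R : realType} {H : hilbertType R}.
Implicit Types (N : set (projection H)) (P Q : projection H).
Implicit Types (S T : bop H) (A L : set (bop H)).

Definition complete_sublattice N := forall M, M `<=` N ->
  (exists2 P, supremums M P & N P) /\ (exists2 P, infimums M P & N P).

Definition complete_nest N :=
  [/\ total_on N (fun P Q => (P <= Q)%O), N proj0, N proj1
    & complete_sublattice N].

(* [supremum proj0 set0 = proj0], so this is [proj0] at [P = proj0]. *)
Definition nest_pred N P := supremum proj0 [set Q | N Q /\ (Q < P)%O].

Definition continuous_nest N :=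
  complete_nest N /\ forall P, N P -> nest_pred N P = P.

Definition nest_algebra N : set (bop H) :=
  [set T | forall P, N P -> (1 - (P : bop H)) * T * P = 0].

Definition complex_subspace L :=
  L 0 /\ forall (a : R[i]) S T, L S -> L T -> L (a *: S + T).

Definition commutator T S := T * S - S * T.

Definition lie_ideal A L :=
  [/\ L `<=` A, complex_subspace L
    & forall T S, L T -> A S -> L (commutator T S)].

Definition lin_indep n (v : 'I_n -> H) :=
  forall c : 'I_n -> R[i], \sum_i c i *: v i = 0 -> forall i, c i = 0.

Definition has_rank T n := exists2 v : 'I_n -> H, lin_indep v &
  range T = [set \sum_i c i *: v i | c in [set: 'I_n -> R[i]]].

Definition finite_rank T := exists n, has_rank T n.

Definition rank_one T := has_rank T 1.

End NestAlgebras.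

(* Main.v *)
Require Import Defs.
From HB Require Import structures.
From mathcomp Require Import all_boot all_order all_algebra.
From mathcomp Require Import sesquilinear complex.
From mathcomp Require Import boolp classical_sets functions reals.
From mathcomp Require Import interval_inference topology normedtype.
From mathcomp Require Import ring.

Set Implicit Arguments.
Unset Strict Implicit.
Unset Printing Implicit Defensive.

Import Order.TTheory GRing.Theory Num.Theory.
Import numFieldNormedType.Exports.

Local Open Scope classical_set_scope.
Local Open Scope ring_scope.

(** The theorem holds because one can split off one rank one summand of [T] at
a time, inside [L], each time shrinking the range of [T]; which summand to
choose is dictated by the nest.

Let [P] be the largest element of the nest with [T P = 0]; it exists because
the functionals [x |-> <T x, b>] are represented by vectors, and a supremum of
projections annihilating a vector annihilates it ([max_annihilated]). As [Q]
decreases to [P] within the nest, the nonzero subspaces [T Q H] decrease inside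
the finite dimensional range of [T], so they share a vector [u <> 0]
([chain_common_vector], [common_range_vector]). Two consequences of continuity
of the nest are used: [P] is the infimum of the [Q > P] in the nest
([continuous_nest_inf]), and each vector annihilated by [P] is a limit of
vectors annihilated by some [Q > P] ([inf_kernel_dense], from the projection
theorem).

Write [u (x) z] for [x |-> <x, z> u]. Since [T] leaves every [Q H] invariant,
[u] lies in [Q H] for every [Q > P], hence in [P H]. As [T P = 0], the
commutator [[T, P]] is [- P T], so [P T] is in [L]. If [Q > P], [Q z = 0], and
[u = T w] with [w] in [Q H], then [w (x) z] belongs to the nest algebra and
[[P T, w (x) z] = P T w (x) z = u (x) z], because [P z = 0] kills the other
product. So [u (x) z] is in [L] for these [z], and, [L] being closed, for every
[z] with [P z = 0].

Now let [p] be the orthogonal projection onto the line of [u]. Then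
[p T = u (x) z] where [z] is a multiple of the image of [u] under the adjoint
of [T]; as [T P = 0], this [z] satisfies [P z = 0]. Hence [p T] is a rank one
element of [L] ([lie_ideal_peel]), and [T - p T] is an element of [L] whose
range is spanned by one vector less ([span_compl_line]). Induction on the
number of spanning vectors concludes. *)

(** * Inner products and the projection theorem *)

Section HilbertGeometry.
Context {R : realType} {H : hilbertType R}.
Implicit Types (x y z u e : H) (C : set H) (a : R[i]).

Definition linear_subspace C :=
  C 0 /\ forall a x y, C x -> C y -> C (a *: x + y).

Lemma dotZl a x y : dot (a *: x) y = a * dot x y.
Proof. by rewrite linearZl_LR. Qed.

Lemma dotZr a x y : dot x (a *: y) = a^* * dot x y.
Proof. by rewrite linearZr_LR. Qed.

Lemma dotC x y : dot x y = (dot y x)^*.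
Proof. by rewrite hermC /= mul1r. Qed.

Lemma dot_eq0 x : dot x x = 0 -> x = 0.
Proof. by rewrite dot_normE => /eqP; rewrite sqrf_eq0 normr_eq0 => /eqP. Qed.

(** If [y] nearly minimizes the distance from [x] to [C], then [x - y] is nearly
orthogonal to [C]: otherwise moving [y] along [e] would come closer to [x] than
[d] permits. With [C] the whole space this is the Cauchy-Schwarz inequality, and
along a minimizing sequence it yields both the Cauchy property and the
orthogonality of the limit. *)
Lemma dot_almost_nearest C x y d eps e : linear_subspace C ->
  (forall c, C c -> d <= `|x - c| ^+ 2) -> C y -> 0 <= eps ->
  `|x - y| ^+ 2 <= d + eps ^+ 2 -> C e -> `|dot (x - y) e| <= eps * `|e|.
Proof.
move=> [_ C_lin] d_le Cy eps0 xy_le Ce.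
have [->|e0] := eqVneq e 0; first by rewrite linear0r !normr0 mulr0.
have ne0 : 0 < `|e| ^+ 2 by rewrite exprn_gt0 // normr_gt0.
set w := x - y; set b := dot w e; pose a := b / `|e| ^+ 2.
(* [a *: e + y] is the point of the line [y + <e>] nearest to [x]. *)
have Cay : C (a *: e + y) by apply: C_lin.
have := d_le _ Cay.
rewrite opprD addrCA addrC -/w -dot_normE dnormB /= dnormZ dotZr -/b dot_normE.
rewrite (dot_normE e).
have nR : (`|e| ^+ 2)^* = `|e| ^+ 2 by rewrite geC0_conj // exprn_ge0.
have nU : `|e| ^+ 2 != 0 by rewrite gt_eqF.
have aE : a^* * b = `|b| ^+ 2 / `|e| ^+ 2.
  by rewrite /a rmorphM /= fmorphV /= nR normCKC mulrAC.
have nE : `|a| ^+ 2 * `|e| ^+ 2 = `|b| ^+ 2 / `|e| ^+ 2.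
  rewrite /a normrM normfV normrX normr_id.
  by move: nU; move: (`|e|) (`|b|) => n m nU; field; move: nU; rewrite sqrf_eq0.
have bE : (`|b| ^+ 2 / `|e| ^+ 2)^* = `|b| ^+ 2 / `|e| ^+ 2.
  by rewrite geC0_conj // divr_ge0 ?exprn_ge0.
rewrite nE aE bE => d_le'.
have : `|b| ^+ 2 / `|e| ^+ 2 <= eps ^+ 2.
  rewrite -(lerD2l d) (le_trans _ xy_le) // -lerBrDr (le_trans d_le') //.
  by rewrite opprD addrA addrK.
by rewrite ler_pdivrMr // -exprMn ler_sqr // ?nnegrE ?mulr_ge0 //.
Qed.

Lemma dot_CauchySchwarz x e : `|dot x e| <= `|x| * `|e|.
Proof.
rewrite -[x]subr0; apply: (@dot_almost_nearest setT _ _ 0) => //.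
by rewrite add0r.
Qed.

(** This is how facts pass to limits below: for operators, for functionals, and
for [outer u z] as a function of [z], which is conjugate-linear. *)
Lemma lipschitz_closure (V : normedModType R[i]) (f : H -> V) (M : R[i])
    C (A : set V) y :
  (forall x z, `|f x - f z| <= M * `|x - z|) -> closed A ->
  (forall x, C x -> A (f x)) -> closure C y -> A (f y).
Proof.
move=> f_lip A_closed CA Cy.
have M1 : 0 < `|M| + 1 by rewrite ltr_wpDl.
have f_cont : continuous f.
  move=> x; apply/cvgrPdist_lt => e e0; near=> z.
  have h : `|x - z| < e / (`|M| + 1).
    by near: z; apply: cvgr_dist_lt; rewrite ?divr_gt0.
  rewrite (le_lt_trans (f_lip _ _)) //.
  have [->|xz0] := eqVneq x z; first by rewrite subrr normr0 mulr0.
  have xz : 0 < `|x - z| by rewrite normr_gt0 subr_eq0.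
  have MM : M * `|x - z| <= (`|M| + 1) * `|x - z|.
    have M0 : 0 <= M.
      by rewrite -(pmulr_lge0 _ xz) (le_trans _ (f_lip _ _)).
    by rewrite ler_wpM2r // ger0_norm // lerDl.
  by rewrite (le_lt_trans MM) // mulrC -ltr_pdivlMr.
have f_cont' : {in (~` f @^-1` A), continuous f} by move=> x _; apply: f_cont.
apply: (preimage_closed f_cont' A_closed).
exact: (closure_subset (B := f @^-1` A) CA).
Unshelve. all: by end_near. Qed.

(** A minimizing sequence in [C] for the distance to [x] is Cauchy and its limit
is [y]; this is where the completeness of [H] is used. Placing [y] in the
closure of [C] makes the theorem a density criterion as well. *)
Lemma projection_theorem C x : linear_subspace C ->
  exists2 y, closure C y & forall e, C e -> dot (x - y) e = 0.
Proof.
move=> C_sub; have [C0 C_lin] := C_sub.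
pose D := [set complex.Re (`|x - c| ^+ 2) | c in C].
have ReE c : (complex.Re (`|x - c| ^+ 2))%:C%C = `|x - c| ^+ 2.
  by rewrite RRe_real // realX // normr_real.
have D_inf : has_inf D.
  split; first by exists (complex.Re (`|x - 0| ^+ 2)), 0.
  by exists 0 => _ [c _ <-]; rewrite -lecR ReE exprn_ge0.
pose d : R[i] := (inf D)%:C%C.
have d_le c : C c -> d <= `|x - c| ^+ 2.
  by move=> Cc; rewrite -ReE lecR; apply: ge_inf; [case: D_inf|exists c].
have near_d n : exists c, C c /\ `|x - c| ^+ 2 <= d + n.+1%:R^-1 ^+ 2.
  have n0 : 0 < n.+1%:R^-1 ^+ 2 :> R by rewrite exprn_gt0 // invr_gt0.
  have [_ [c Cc <-] /ltW c_le] := inf_adherent n0 D_inf.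
  exists c; split=> //; move: c_le; rewrite -lecR ReE rmorphD rmorphXn fmorphV.
  by rewrite rmorph_nat.
have [c c_near] := choice near_d.
have c_orth n e : C e -> `|dot (x - c n) e| <= n.+1%:R^-1 * `|e|.
  have [Cn hn] := c_near n.
  by apply: (dot_almost_nearest (d := d)) => //; rewrite invr_ge0.
(* Test [c_orth] at [n] and [m] against the vector [c n - c m] itself. *)
have c_dist n m : `|c n - c m| <= m.+1%:R^-1 + n.+1%:R^-1.
  have Ce : C (c n - c m).
    rewrite addrC -scaleN1r.
    by apply: C_lin; case: (c_near m); case: (c_near n).
  have := lerD (c_orth m _ Ce) (c_orth n _ Ce).
  rewrite -mulrDl => /(le_trans (ler_normB _ _)); rewrite -linearBl /=.
  rewrite opprB [_ - _ + _]addrC addrA subrK [m.+1%:R^-1 + _]addrC.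
  have [->|e0] := eqVneq (c n) (c m).
    by rewrite subrr normr0 addr_ge0 ?invr_ge0.
  have ne0 : 0 < `|c n - c m| by rewrite normr_gt0 subr_eq0.
  by rewrite dot_normE normrX normr_id expr2 ler_pM2r.
have inv_lt (e : R[i]) : 0 < e -> \forall n \near \oo, n.+1%:R^-1 < e.
  move=> e0; have eE : (complex.Re e)%:C%C = e by rewrite RRe_real ?gtr0_real.
  have Re0 : 0 < complex.Re e by rewrite -ltcR eE.
  rewrite -eE; move: (complex.Re e) Re0 => _/posnumP[r].
  near=> n; have : n.+1%:R^-1 < r%:num.
    by near: n; apply: near_infty_natSinv_lt.
  by rewrite -ltcR fmorphV rmorph_nat.
have /cauchy_cvgP/cvg_ex[y c_cvg] : cauchy (c @ \oo).
  apply: cauchy_exP => e e0; have e2 : 0 < e / 2 by rewrite divr_gt0.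
  have [n _ /(_ n (leqnn n)) /= n_lt] := inv_lt _ e2.
  exists (c n); near=> m; rewrite -ball_normE /= (le_lt_trans (c_dist _ _)) //.
  by rewrite [e]splitr ltrD //; near: m; apply: inv_lt.
exists y.
  have Cc : \forall n \near \oo, closure C (c n).
    by near=> n; apply: subset_closure; case: (c_near n).
  exact: (closed_cvg _ (@closed_closure _ C) Cc y c_cvg).
move=> e Ce; apply/eqP; rewrite -normr_le0; apply/ler_addgt0Pl => eps eps0.
rewrite addr0; have K0 : 0 < `|e| + 1 by rewrite ltr_wpDl.
have eps2 : 0 < eps / 2 / (`|e| + 1) by rewrite !divr_gt0.
near \oo => n.
have n_lt : n.+1%:R^-1 < eps / 2 / (`|e| + 1) by near: n; apply: inv_lt.
have y_lt : `|y - c n| < eps / 2 / (`|e| + 1).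
  by near: n; apply: cvgr_dist_lt.
have -> : x - y = (x - c n) - (y - c n) by rewrite opprB addrA subrK.
rewrite linearBl (le_trans (ler_normB _ _)) // [eps]splitr.
have small (t : R[i]) : t < eps / 2 / (`|e| + 1) -> t * `|e| <= eps / 2.
  move=> t_lt; rewrite (le_trans (ler_wpM2r _ (ltW t_lt))) //.
  by rewrite mulrAC ler_pdivrMr // ler_wpM2l ?lerDl // ltW // divr_gt0.
rewrite lerD ?(le_trans (c_orth n _ Ce)) ?small //.
by rewrite (le_trans (dot_CauchySchwarz _ _)) ?small.
Unshelve. all: by end_near. Qed.

(** The representing vector is a multiple of the component of any [x] with
[f x != 0] orthogonal to the kernel of [f]. *)
Lemma riesz (f : H -> R[i]) (M : R[i]) :
  (forall a x y, f (a *: x + y) = a * f x + f y) ->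
  (forall x, `|f x| <= M * `|x|) -> exists z, forall x, f x = dot x z.
Proof.
move=> f_lin f_le.
have f0 : f 0 = 0.
  by have := f_lin (-1) 0 0; rewrite scaler0 addr0 mulN1r addNr.
have fZ a x : f (a *: x) = a * f x.
  by rewrite -[a *: x]addr0 f_lin f0 addr0.
have fB x y : f (x - y) = f x - f y.
  by rewrite -scaleN1r addrC f_lin mulN1r addrC.
have [[x fx0]|f_null] := pselect (exists x, f x != 0); last first.
  exists 0 => x; rewrite linear0r; apply: contrapT => /eqP fx0.
  by apply: f_null; exists x.
have ker_sub : linear_subspace [set x | f x = 0].
  by split=> [|a y z /= fy fz]; rewrite /= ?f0 // f_lin fy fz mulr0 addr0.
have [y ker_y y_orth] := projection_theorem x ker_sub.
have fy : f y = 0.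
  apply: (lipschitz_closure (V := R[i]^o) (f := f) (M := M)
    (C := [set x | f x = 0]) (A := [set 0])) => //.
    by move=> u v; rewrite -fB; apply: f_le.
  exact/accessible_closed_set1/hausdorff_accessible/norm_hausdorff.
set w := x - y in y_orth; have fw : f w = f x by rewrite fB fy subr0.
have w0 : dot w w != 0.
  by apply: contraNneq fx0 => /dot_eq0 w0; rewrite -fw w0 f0.
exists ((f w / dot w w)^* *: w) => v; rewrite dotZr conjCK.
have /y_orth : f (v - (f v / f w) *: w) = 0 by rewrite fB fZ fw divfK ?subrr.
rewrite dotC => /eqP; rewrite conjC_eq0 linearBl /= dotZl subr_eq0 => /eqP ->.
by rewrite fw; field; rewrite fx0 w0.
Qed.

(** The vector [z] is the value at [b] of the adjoint of [T]. *)
Lemma bop_adjoint (T : bop H) b : exists z, forall x, dot (T x) b = dot x z.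
Proof.
apply: (@riesz (fun x => dot (T x) b) ((opnorm T)%:C%C * `|b|)) => [a x y|x].
  by rewrite linearP linearDl /= dotZl.
rewrite (le_trans (dot_CauchySchwarz _ _)) // mulrAC ler_wpM2r //.
exact: opnormP.
Qed.

(** * Rank one operators and projections *)

Fact outer_subproof u z : (fun x => dot x z *: u) \in @bounded_linear R H.
Proof.
apply/asboolP; split=> [a x y|].
  by rewrite linearDl /= dotZl scalerDl scalerA.
exists (complex.Re (`|z| * `|u|)) => x.
rewrite RRe_real ?realM ?normr_real // normrZ.
by rewrite [leRHS]mulrC mulrA ler_wpM2r // dot_CauchySchwarz.
Qed.

Definition outer u z : bop H := Bop (outer_subproof u z).

Lemma outerE u z x : outer u z x = dot x z *: u. Proof. by []. Qed.

Lemma mul_outer (T : bop H) u z : T * outer u z = outer (T u) z.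
Proof. by apply: bopP => x; rewrite bop_mulE !outerE linearZ. Qed.

Lemma outer_closure C (A : set (bop H)) u z : closed A ->
  (forall y, C y -> A (outer u y)) -> closure C z -> A (outer u z).
Proof.
move=> A_closed CA.
apply: (lipschitz_closure (f := outer u) (M := `|u|) (C := C)) => // x y.
have uxyE : (complex.Re (`|u| * `|x - y|))%:C%C = `|u| * `|x - y|.
  by rewrite RRe_real // realM ?normr_real.
rewrite -[leLHS]/((opnorm (outer u x - outer u y))%:C%C) -uxyE lecR.
apply: opnorm_lub => v v1; rewrite uxyE bop_addE bop_oppE !outerE -scalerBl.
rewrite -linearBr normrZ mulrC ler_wpM2l //.
rewrite (le_trans (dot_CauchySchwarz _ _)) //.
by rewrite ler_piMl.
Qed.

Lemma outer_rank_one u z : outer u z != 0 -> rank_one (outer u z).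
Proof.
move=> uz0; have u0 : u != 0.
  by apply: contraNneq uz0 => ->; apply/eqP/bopP => x; rewrite outerE scaler0.
have z0 : dot z z != 0.
  apply: contraNneq uz0 => /dot_eq0 ->; apply/eqP/bopP => x.
  by rewrite outerE linear0r scale0r.
exists (fun=> u) => [c|].
  rewrite big_ord1 => /eqP; rewrite scaler_eq0 (negPf u0) orbF => /eqP c0 i.
  by rewrite ord1.
apply/seteqP; split=> [_ [x _ <-]|_ [c _ <-]].
  by exists (fun=> dot x z); rewrite // big_ord1.
exists ((c ord0 / dot z z) *: z) => //.
by rewrite big_ord1 outerE dotZl divfK.
Qed.

Lemma conj_normV2 x : (`|x| ^- 2)^* = `|x| ^- 2.
Proof. by rewrite geC0_conj // invr_ge0 exprn_ge0. Qed.

Fact line_projection_subproof u :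
  outer u (`|u| ^- 2 *: u) \in @orthogonal_projection R H.
Proof.
have [->|u0] := eqVneq u 0.
  apply/asboolP; split; last first.
    by move=> x y; rewrite !outerE !scaler0 linear0l linear0r.
  by apply: bopP => x; rewrite bop_mulE !outerE !scaler0.
have cV := conj_normV2 u.
have nu : `|u| ^+ 2 != 0 by rewrite expf_neq0 // normr_eq0.
apply/asboolP; split=> [|x y].
  apply: bopP => x.
  rewrite bop_mulE !outerE !dotZr cV linearZl_LR /= dot_normE.
  by congr (_ *: _); field; rewrite normr_eq0.
by rewrite !outerE !dotZr cV dotZl rmorphM /= cV -dotC; ring.
Qed.

(** For [u = 0] the formula gives the zero projection. *)
Definition line_projection u := Projection (line_projection_subproof u).

Lemma line_projectionE u x :
  line_projection u x = (dot x u / `|u| ^+ 2) *: u.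
Proof. rewrite -[LHS]/(dot x (`|u| ^- 2 *: u) *: u) dotZr conj_normV2.
by rewrite mulrC. Qed.

Lemma line_projection_id u : line_projection u u = u.
Proof.
have [->|u0] := eqVneq u 0; first by rewrite linear0.
by rewrite line_projectionE dot_normE divff ?scale1r // expf_neq0 // normr_eq0.
Qed.

Lemma line_projection_orth u z : dot z u = 0 -> line_projection u z = 0.
Proof. by rewrite line_projectionE => ->; rewrite mul0r scale0r. Qed.

Fact compl_projection_subproof (P : projection H) :
  (1 - (P : bop H)) \in @orthogonal_projection R H.
Proof.
apply/asboolP; split=> [|x y].
  by rewrite mulrBr mulr1 mulrBl mul1r projection_idem subrr subr0.
by rewrite linearBl linearBr /= projection_sym.
Qed.

Definition compl_projection P := Projection (compl_projection_subproof P).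

Lemma proj_le_fixed (P Q : projection H) x : (P <= Q)%O -> P x = x -> Q x = x.
Proof. by move=> /proj_leP QP Px; rewrite -[in LHS]Px -bop_mulE QP. Qed.

Lemma proj_le_kernel (P Q : projection H) x : (P <= Q)%O -> Q x = 0 -> P x = 0.
Proof.
move=> /proj_leP QP Qx; apply: dot_eq0.
have QPx : Q (P x) = P x by rewrite -bop_mulE QP.
rewrite projection_sym -bop_mulE projection_idem -QPx -projection_sym Qx.
by rewrite linear0l.
Qed.

(** Together with [le_compl_line], this turns fixing or annihilating a vector
into comparison with a projection, so that suprema and infima taken in the
poset of projections can be evaluated on vectors. *)
Lemma line_le (P : projection H) u : P u = u -> (line_projection u <= P)%O.
Proof.
move=> Pu; apply/proj_leP/bopP => x.
by rewrite bop_mulE line_projectionE linearZ /= Pu.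
Qed.

Lemma le_compl_line (P : projection H) z :
  (P <= compl_projection (line_projection z))%O <-> P z = 0.
Proof.
split=> [/proj_leP le_P|Pz].
  have Pz : compl_projection (line_projection z) (P z) = P z.
    by rewrite -bop_mulE le_P.
  apply: dot_eq0; rewrite [LHS]projection_sym -bop_mulE projection_idem -Pz.
  rewrite -projection_sym -[compl_projection _ z]/(z - line_projection z z).
  by rewrite line_projection_id subrr linear0l.
apply/proj_leP/bopP => x; rewrite bop_mulE bop_addE bop_oppE.
by rewrite line_projection_orth ?subr0 // projection_sym Pz linear0r.
Qed.

End HilbertGeometry.

(** * Chains of subspaces of a finite dimensional space *)

Section FiniteDimension.
Context {R : realType} {H : hilbertType R}.

Definition span_fam n (v : 'I_n -> H) : set H :=
  [set x | exists c : 'I_n -> R[i], x = \sum_i c i *: v i].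

Lemma span_fam_subspace n (v : 'I_n -> H) : linear_subspace (span_fam v).
Proof.
split=> [|a _ _ [c ->] [d ->]].
  by exists (fun=> 0); rewrite big1 // => i _; rewrite scale0r.
exists (fun i => a * c i + d i); rewrite scaler_sumr -big_split /=.
by apply: eq_bigr => i _; rewrite scalerDl scalerA.
Qed.

(** A chain of nonzero subspaces of a finite dimensional space has a nonzero
intersection. By induction on the number of spanning vectors: if the traces of
all members on the span of all but the first vector are nonzero, the induction
hypothesis applies to these traces; otherwise some member meets that span
trivially, hence is a line, and lies in every member. *)
Lemma chain_common_vector (I : Type) (M : set I) (V : I -> set H) n
    (v : 'I_n -> H) :
  M !=set0 -> (forall i, M i -> linear_subspace (V i)) ->
  (forall i, M i -> exists2 x, V i x & x != 0) ->
  (forall i j, M i -> M j -> V i `<=` V j \/ V j `<=` V i) ->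
  (forall i, M i -> V i `<=` span_fam v) ->
  exists2 u, u != 0 & forall i, M i -> V i u.
Proof.
move=> [i0 Mi0]; elim: n V v => [|n IHn] V v V_sub V_neq0 V_chain V_span.
  have [x Vx] := V_neq0 _ Mi0; have [c ->] := V_span _ Mi0 _ Vx.
  by rewrite big_ord0 eqxx.
pose v' (k : 'I_n) := v (lift ord0 k).
pose W i := V i `&` span_fam v'.
have [W_neq0|] := pselect (forall i, M i -> exists2 x, W i x & x != 0).
  have [|||u u0 Wu] := IHn W v' _ W_neq0.
  - move=> i Mi; have [V0 V_lin] := V_sub i Mi.
    have [S0 S_lin] := span_fam_subspace v'.
    by split=> // a x y [? ?] [? ?]; split; [apply: V_lin | apply: S_lin].
  - by move=> i j Mi Mj; case: (V_chain i j Mi Mj) => VV; [left | right];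
      move=> x [Vx Sx]; split=> //; apply: VV.
  - by move=> i _ x [].
  by exists u => // i /Wu[].
move=> /existsNP[i /not_implyP[Mi Wi0]].
have Wi_eq0 x : W i x -> x = 0.
  by move=> Wx; apply/eqP; apply: contra_notT Wi0 => x0; exists x.
have [u Vu u0] := V_neq0 i Mi; exists u => // j Mj.
have [Vij|Vji] := V_chain i j Mi Mj; first exact: Vij.
have [x Vx x0] := V_neq0 j Mj.
have [c xE] := V_span _ Mj _ Vx; have [d uE] := V_span _ Mi _ Vu.
have c0 : c ord0 != 0.
  apply: contra_neq x0 => c0; apply: Wi_eq0; split; first exact: Vji.
  by exists (c \o lift ord0); rewrite xE big_ord_recl c0 scale0r add0r.
pose a := d ord0 / c ord0.
(* The first coordinates of [u] and [a *: x] agree. *)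
have uxE : - a *: x + u = 0.
  apply: Wi_eq0; split; first by apply: (V_sub i Mi).2 => //; apply: Vji.
  exists (fun k => - a * c (lift ord0 k) + d (lift ord0 k)).
  rewrite xE uE !big_ord_recl scalerDr scaler_sumr addrACA -big_split /=.
  rewrite !scalerA -scalerDl mulNr divfK // addNr scale0r add0r.
  by apply: eq_bigr => k _; rewrite scalerA -scalerDl.
have [V0 V_lin] := V_sub j Mj.
have -> : u = a *: x + 0.
  by move/eqP: uxE; rewrite addr0 scaleNr addrC subr_eq0 => /eqP.
exact: V_lin.
Qed.

(** Projecting along [u] kills a nontrivial linear combination of the [v i], so
the image of one of them is spanned by the images of the others. *)
Lemma span_compl_line n (v : 'I_n.+1 -> H) u : u != 0 -> span_fam v u ->
  exists v' : 'I_n -> H,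
    forall x, span_fam v x -> span_fam v' (x - line_projection u x).
Proof.
move=> u0 [c uE].
have [j cj0] : exists j, c j != 0.
  apply: contrapT => c_eq0; move/eqP: u0; apply; rewrite uE big1 // => i _.
  have [->|ci0] := eqVneq (c i) 0; first by rewrite scale0r.
  by exfalso; apply: c_eq0; exists i.
pose q : bop H := 1 - (line_projection u : bop H).
have qE x : x - line_projection u x = q x by [].
have qu : q u = 0 by rewrite -qE line_projection_id subrr.
clearbody q.
exists (fun k => q (v (lift j k))) => _ [d ->].
set x := \sum_i _; rewrite qE.
exists (fun k => d (lift j k) - d j / c j * c (lift j k)).
have -> : q x = q (x - (d j / c j) *: u).
  have qB a : q (x - a *: u) = q x - a *: q u by rewrite linearB linearZ.
  by rewrite qB qu scaler0 subr0.
rewrite {}/x uE scaler_sumr -sumrB (bigD1_ord j) //=.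
rewrite scalerA divfK // subrr add0r.
rewrite linear_sum; apply: eq_bigr => k _.
by rewrite scalerA -scalerBl linearZ.
Qed.

End FiniteDimension.

(** * Projections and continuous nests *)

Section Nests.
Context {R : realType} {H : hilbertType R}.
Implicit Types (N M : set (projection H)) (P Q : projection H) (T : bop H).

Lemma inf_fixed M P u : infimums M P -> (forall Q, M Q -> Q u = u) -> P u = u.
Proof.
move=> [_ P_glb] Mu; apply: (proj_le_fixed _ (line_projection_id u)).
by apply: P_glb => Q MQ; apply: line_le; apply: Mu.
Qed.

Lemma sup_kernel M P z : supremums M P -> (forall Q, M Q -> Q z = 0) -> P z = 0.
Proof.
move=> [_ P_lub] Mz; apply/le_compl_line.
by apply: P_lub => Q MQ; apply/le_compl_line; apply: Mz.
Qed.

(** Strong convergence of a decreasing chain of projections to its infimum, on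
the kernel of the latter. If [z - y] is orthogonal to all the kernels, it is
fixed by every [Q] in [M], hence by [P]; but [P] annihilates both [z] and
[y]. *)
Lemma inf_kernel_dense M P z :
  M !=set0 -> total_on M (fun Q Q' => (Q <= Q')%O) ->
  infimums M P -> P z = 0 -> closure [set y | exists2 Q, M Q & Q y = 0] z.
Proof.
move=> [Q0 MQ0] M_tot P_inf Pz; set C := [set y | _].
have C_sub : linear_subspace C.
  split=> [|a x y [Q MQ Qx] [Q' MQ' Qy]]; first by exists Q0; rewrite ?linear0.
  case: (M_tot Q Q' MQ MQ') => [le_Q|le_Q].
    exists Q => //.
    by rewrite linearP /= Qx (proj_le_kernel le_Q Qy) scaler0 addr0.
  exists Q' => //.
  by rewrite linearP /= Qy (proj_le_kernel le_Q Qx) scaler0 addr0.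
have [y Cy y_orth] := projection_theorem z C_sub.
have Pw : P (z - y) = z - y.
  apply: (inf_fixed P_inf) => Q MQ.
  have Q'w : compl_projection Q (z - y) = 0.
    apply: dot_eq0; rewrite projection_sym -bop_mulE projection_idem.
    apply: y_orth; exists Q => //.
    rewrite -[compl_projection Q _]/((z - y) - Q (z - y)) linearB /=.
    by rewrite -(bop_mulE Q Q) projection_idem subrr.
  by apply/esym/eqP; rewrite -subr_eq0; apply/eqP.
have Py : P y = 0.
  apply: (lipschitz_closure (f := P) (M := (opnorm P)%:C%C)
    (C := C) (A := [set 0])) => //.
  - by move=> x x'; rewrite -linearB; apply: opnormP.
  - exact/accessible_closed_set1/hausdorff_accessible/norm_hausdorff.
  - by move=> x [Q MQ Qx]; apply: proj_le_kernel Qx; case: P_inf => /(_ Q MQ).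
have /eqP : z - y = 0 by rewrite -Pw linearB /= Pz Py subrr.
by rewrite subr_eq0 => /eqP ->.
Qed.

(** If the infimum [P'] of the elements above [P] were larger than [P], nothing
would lie strictly between [P] and [P'], so the predecessor of [P'] would be at
most [P], against continuity at [P']. *)
Lemma continuous_nest_inf N P : continuous_nest N -> N P ->
  infimums [set Q | N Q /\ (P < Q)%O] P.
Proof.
move=> [[N_tot _ _ N_compl] N_cont] NP; set M := [set Q | _].
have [|_ [P' P'_inf NP']] := N_compl M; first by move=> Q [].
suff <- : P' = P by [].
apply: contrapT => P'P.
have lt_P : (P < P')%O.
  rewrite lt_neqAle; apply/andP; split; first by apply/eqP => PP'; apply: P'P.
  by apply: P'_inf.2 => Q [_ /ltW].
have [|[S S_sup _] _] := N_compl [set Q | N Q /\ (Q < P')%O].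
  by move=> Q [].
have : nest_pred N P' = S.
  rewrite /nest_pred /supremum ifF; last first.
    by apply/eqP => E; have : set0 P by rewrite -E.
  case: xgetP => [S' _ S'_sup|/(_ S)//].
  exact: is_subset1_supremums S'_sup S_sup.
rewrite N_cont // => P'S.
have : (S <= P)%O.
  apply: S_sup.2 => Q [NQ QP'].
  case: (N_tot Q P NQ NP) => // le_PQ.
  have [->|PQ] := eqVneq P Q; first exact: lexx.
  have {}PQ : (P < Q)%O by rewrite lt_neqAle PQ.
  have /(lt_le_trans QP') : (P' <= Q)%O by apply: P'_inf.1.
  by rewrite ltxx.
by rewrite -P'S => /(lt_le_trans lt_P); rewrite ltxx.
Qed.

Lemma nest_algebra_proj N P : total_on N (fun Q Q' => (Q <= Q')%O) -> N P ->
  nest_algebra N P.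
Proof.
move=> N_tot NP Q NQ; case: (N_tot P Q NP NQ) => /proj_leP QP.
  by rewrite mulrBl mul1r QP subrr mul0r.
by rewrite -mulrA QP mulrBl mul1r projection_idem subrr.
Qed.

Lemma nest_algebra_outer N P u z : total_on N (fun Q Q' => (Q <= Q')%O) ->
  N P -> P u = u -> P z = 0 -> nest_algebra N (outer u z).
Proof.
move=> N_tot NP Pu Pz Q NQ; apply: bopP => x.
rewrite mul_outer bop_mulE outerE.
case: (N_tot P Q NP NQ) => le_Q.
  rewrite -[X in _ *: X]/(u - Q u) (proj_le_fixed le_Q Pu) subrr.
  exact: scaler0.
by rewrite projection_sym (proj_le_kernel le_Q Pz) linear0r scale0r.
Qed.

End Nests.

(** * Splitting off a rank one element of the Lie ideal *)

Section LieIdeals.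
Context {R : realType} {H : hilbertType R}.
Implicit Types (N : set (projection H)) (L : set (bop H)) (T : bop H).

(** That [T] still annihilates the supremum is tested against each [b]: the
adjoint of [T] maps [b] to a vector annihilated by all the [Q] with [T Q = 0],
hence by their supremum. *)
Lemma max_annihilated N T : complete_sublattice N ->
  exists P, [/\ N P, T * P = 0 & forall Q, N Q -> T * Q = 0 -> (Q <= P)%O].
Proof.
move=> N_compl; pose M : set (projection H) := [set Q | N Q /\ T * Q = 0].
have [|[P P_sup NP] _] := N_compl M; first by move=> Q [].
exists P; split=> // [|Q NQ TQ]; last by apply: P_sup.1.
apply: bopP => x; apply: dot_eq0; rewrite bop_mulE.
have [z zE] := bop_adjoint T (T (P x)).
rewrite zE projection_sym (sup_kernel (z := z) P_sup) ?linear0r // => Q [_ TQ].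
apply: dot_eq0; rewrite projection_sym.
by rewrite dotC -zE -bop_mulE TQ linear0l conjC0.
Qed.

Lemma common_range_vector N T P n (v : 'I_n -> H) :
  total_on N (fun Q Q' => (Q <= Q')%O) -> N proj1 ->
  (forall Q, N Q -> T * Q = 0 -> (Q <= P)%O) -> T != 0 -> T * P = 0 ->
  (forall x, span_fam v (T x)) ->
  exists2 u, u != 0 & forall Q, N Q -> (P < Q)%O -> exists x, T (Q x) = u.
Proof.
move=> N_tot N1 P_max T0 TP0 T_span.
pose M : set (projection H) := [set Q | N Q /\ (P < Q)%O].
have [|||||u u0 Vu] := @chain_common_vector _ _ _ M
    (fun Q => range (T * Q)) _ v; last 1 first.
- by exists u => // Q NQ PQ; have [x _ <-] := Vu Q (conj NQ PQ); exists x.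
- exists proj1; split=> //; rewrite lt_neqAle; apply/andP; split.
    by apply: contra_neq T0 => P1; rewrite -TP0 P1 mulr1.
  by apply/proj_leP; rewrite mul1r.
- move=> Q _; split; first by exists 0; rewrite ?linear0.
  by move=> a _ _ [x _ <-] [y _ <-]; exists (a *: x + y); rewrite ?linearP.
- move=> Q [NQ PQ]; apply: contrapT => V0.
  have /(lt_le_trans PQ) : (Q <= P)%O.
    apply: P_max => //; apply: bopP => x; apply: contrapT => /eqP TQx.
    by apply: V0; exists ((T * Q) x) => //; exists x.
  by rewrite ltxx.
- have sub (Q Q' : projection H) :
      (Q <= Q')%O -> range (T * Q) `<=` range (T * Q').
    move=> /proj_leP Q'Q _ [x _ <-]; exists (Q x) => //.
    by rewrite -!bop_mulE -mulrA Q'Q.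
  move=> Q Q' [NQ _] [NQ' _].
  by case: (N_tot Q Q' NQ NQ') => /sub; [left|right].
- by move=> Q _ _ [x _ <-]; apply: T_span.
Qed.

(** The step of the induction. The vector [u] is taken in [T Q H] for every [Q]
above the largest [P] with [T P = 0]; this freedom is what lets [z] range over
all of the kernel of [P]. *)
Lemma lie_ideal_peel N L T n (v : 'I_n -> H) :
  continuous_nest N -> lie_ideal (nest_algebra N) L -> closed L ->
  L T -> T != 0 -> (forall x, span_fam v (T x)) ->
  exists u, [/\ u != 0, exists x, T x = u
    & exists2 z, (line_projection u : bop H) * T = outer u z & L (outer u z)].
Proof.
move=> N_cont [L_sub [L0 L_lin] L_lie] L_closed LT T0 T_span.
have [[N_tot _ N1 N_compl] _] := N_cont.
have [P [NP TP P_max]] := max_annihilated T N_compl.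
have [u u0 u_range] := common_range_vector N_tot N1 P_max T0 TP T_span.
pose M : set (projection H) := [set Q | N Q /\ (P < Q)%O].
have P_inf : infimums M P by apply: continuous_nest_inf.
have M1 : M proj1.
  split=> //; rewrite lt_neqAle; apply/andP; split.
    by apply: contra_neq T0 => P1; rewrite -TP P1 mulr1.
  by apply/proj_leP; rewrite mul1r.
have Pu : P u = u.
  apply: (inf_fixed P_inf) => Q [NQ PQ]; have [x <-] := u_range Q NQ PQ.
  have /(congr1 (fun S : bop H => S x)) := L_sub T LT Q NQ.
  rewrite -[LHS]/(T (Q x) - Q (T (Q x))) => /eqP.
  by rewrite subr_eq0 => /eqP.
(* [T P = 0], so the commutator of [T] and [P] is [- P T]. *)
have LPT : L ((P : bop H) * T).
  have /(L_lin (-1) _ 0) /(_ L0) := L_lie _ _ LT (nest_algebra_proj N_tot NP).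
  by rewrite /commutator TP sub0r scaleN1r opprK addr0.
have L_above z : closure [set y | exists2 Q, M Q & Q y = 0] z -> L (outer u z).
  apply: outer_closure => // {}z [Q [NQ PQ] Qz].
  have [x xE] := u_range Q NQ PQ.
  pose w := Q x.
  have Qw : Q w = w by rewrite /w -bop_mulE projection_idem.
  have := L_lie _ _ LPT (nest_algebra_outer N_tot NQ Qw Qz).
  rewrite /commutator mul_outer bop_mulE xE Pu.
  suff -> : outer w z * ((P : bop H) * T) = 0 by rewrite subr0.
  apply: bopP => y; rewrite mulrA !bop_mulE outerE projection_sym.
  by rewrite (proj_le_kernel (ltW PQ) Qz) linear0r scale0r.
exists u; split=> //.
  by have [x <-] := u_range _ N1 M1.2; exists x.
have [z zE] := bop_adjoint T u.
exists (`|u| ^- 2 *: z).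
  apply: bopP => x; rewrite bop_mulE line_projectionE outerE zE.
  by rewrite dotZr conj_normV2 mulrC.
apply: L_above; apply: (inf_kernel_dense _ _ P_inf); first by exists proj1.
  by move=> Q Q' [NQ _] [NQ' _]; apply: N_tot.
rewrite linearZ /=; suff -> : P z = 0 by rewrite scaler0.
apply: dot_eq0; rewrite -projection_sym.
by rewrite -zE -bop_mulE TP linear0l.
Qed.

(** The induction is on the length of a spanning family rather than on the rank:
[span_compl_line] yields a shorter family, but keeps no track of
independence. *)
Lemma lie_ideal_decomposition N L n (v : 'I_n -> H) T :
  continuous_nest N -> lie_ideal (nest_algebra N) L -> closed L ->
  L T -> (forall x, span_fam v (T x)) ->
  exists2 s : seq (bop H),
    (forall S, S \in s -> rank_one S /\ L S) & T = \sum_(S <- s) S.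
Proof.
move=> N_cont L_lie L_closed; elim: n v T => [|n IHn] v T LT T_span.
  exists [::] => //; rewrite big_nil; apply: bopP => x.
  by have [c ->] := T_span x; rewrite big_ord0.
have [->|T0] := eqVneq T 0; first by exists [::]; rewrite ?big_nil.
have [u [u0 [a Ta] [z uzE Luz]]] :=
  lie_ideal_peel N_cont L_lie L_closed LT T0 T_span.
have u_span : span_fam v u by rewrite -Ta.
have [v' v'_span] := span_compl_line u0 u_span.
have [_ [_ L_lin] _] := L_lie.
have [|x|s sL sE] := IHn v' (T - outer u z).
- by rewrite addrC -scaleN1r; apply: L_lin.
- have -> : (T - outer u z) x = T x - line_projection u (T x).
    by rewrite -bop_mulE uzE.
  exact: v'_span (T_span x).
exists (outer u z :: s); last by rewrite big_cons -sE addrC subrK.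
move=> S; rewrite in_cons => /predU1P[->|/sL//]; split=> //.
apply: outer_rank_one; apply: contra_neq u0 => uz0.
by rewrite -(line_projection_id u) -{2}Ta -bop_mulE uzE uz0.
Qed.

End LieIdeals.

Theorem theorem3p5 (R : realType) (H : hilbertType R)
    (N : set (projection H)) (L : set (bop H)) (T : bop H) :
  continuous_nest N ->
  lie_ideal (nest_algebra N) L -> closed L ->
  L T -> finite_rank T ->
  exists2 s : seq (bop H),
    (forall S, S \in s -> rank_one S /\ L S) & T = \sum_(S <- s) S.
Proof.
move=> N_cont L_lie L_closed LT [n [v _ T_range]].
apply: (@lie_ideal_decomposition _ _ N L n v) => // x.
have : range T (T x) by exists x.
by rewrite T_range => -[c _ <-]; exists c.
Qed.
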